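(* Let $G=\ast_{j\in J} A_j$ be a free product of nontrivial groups and let $n$ be a positive integer. If $a\in A_{j_1}$ and $t\in A_{j_2}$ are nonidentity elements with $j_1\neq j_2$ and $\mathrm{ord}(a)\le \mathrm{ord}(t)$, then $$\mathrm{cl}([a,t]^n) = \left\lfloor \frac{n}{2}\right\rfloor - \left\lfloor \frac{n}{\mathrm{ord}(a)}\right\rfloor + 1.$$
   Context: $[x,y]=x^{-1}y^{-1}xy$. The commutator length $\mathrm{cl}(h)$ of an element $h$ of the commutator subgroup of a group is the minimal $k$ such that $h$ is a product of $k$ commutators. $\mathrm{ord}(a)$ is the order of $a$ (possibly $\infty$); if $\mathrm{ord}(a)=\infty$, the term $\lfloor n/\mathrm{ord}(a)\rfloor$ is interpreted as $0$. $\lfloor x\rfloor$ denotes the integer part of $x$. *)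

(* Defs.v *)
From Stdlib Require Import Arith List.
Import ListNotations.

Record group := Group {
  carrier :> Type;
  gmul : carrier -> carrier -> carrier;
  gone : carrier;
  ginv : carrier -> carrier;
  gmulA : forall x y z, gmul x (gmul y z) = gmul (gmul x y) z;
  gmul1l : forall x, gmul gone x = x;
  gmul1r : forall x, gmul x gone = x;
  gmulVl : forall x, gmul (ginv x) x = gone;
  gmulVr : forall x, gmul x (ginv x) = gone
}.

Arguments gmul {g} _ _.
Arguments gone {g}.
Arguments ginv {g} _.

Record hom (G H : group) := Hom {
  hmap :> G -> H;
  hmapM : forall x y, hmap (gmul x y) = gmul (hmap x) (hmap y)
}.
Arguments hmap {G H} _ _.

Definition is_free_product (J : Type) (A : J -> group) (G : group)
    (inj : forall j, hom (A j) G) : Prop :=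
  forall (H : group) (f : forall j, hom (A j) H),
    exists phi : hom G H,
      (forall j (x : A j), phi (inj j x) = f j x) /\
      (forall psi : hom G H, (forall j (x : A j), psi (inj j x) = f j x) ->
         forall g, psi g = phi g).

Definition nontrivial (G : group) : Prop := exists x : G, x <> gone.

Fixpoint gpow {G : group} (x : G) (n : nat) : G :=
  match n with
  | 0 => gone
  | S m => gmul x (gpow x m)
  end.

Definition comm {G : group} (x y : G) : G :=
  gmul (ginv x) (gmul (ginv y) (gmul x y)).

Fixpoint prod_comm {G : group} (l : list (G * G)) : G :=
  match l with
  | [] => gone
  | (x, y) :: l' => gmul (comm x y) (prod_comm l')
  end.

Definition comm_length {G : group} (h : G) (k : nat) : Prop :=
  (exists l : list (G * G), length l = k /\ prod_comm l = h) /\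
  (forall l : list (G * G), prod_comm l = h -> k <= length l).

Definition has_order {G : group} (x : G) (o : option nat) : Prop :=
  match o with
  | Some m => 0 < m /\ gpow x m = gone /\
              (forall k, 0 < k < m -> gpow x k <> gone)
  | None => forall k, 0 < k -> gpow x k <> gone
  end.

Definition ord_le (o1 o2 : option nat) : Prop :=
  match o1, o2 with
  | _, None => True
  | None, Some _ => False
  | Some m, Some k => m <= k
  end.

(* floor(n / ord), interpreted as 0 when ord is infinite *)
Definition div_ord (n : nat) (o : option nat) : nat :=
  match o with
  | Some m => n / m
  | None => 0
  end.

(* Main.v *)
From HB Require Import structures.
From mathcomp Require Import all_boot fingroup perm boolp zify.
Require Import Defs.
From Stdlib Require Import Arith.

Set Implicit Arguments.
Unset Strict Implicit.
Unset Printing Implicit Defensive.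

Local Open Scope group_scope.

(** Write [[~ a, t] = x * y] with [x = a^-1] and [y = a ^ t], and [w = x * y].

    Upper bound: conjugate elements are equal up to one commutator, so an odd
    power [w ^+ m] is equal to [x ^+ m * y ^+ m] up to [m./2] commutators.  If
    [a ^+ N = 1], put [M = N] or [M = 2 * N], whichever is even; combining such a
    splitting with one in the opposite order, [w ^+ M] is equal to
    [x ^+ e * (x ^- e) ^ (w ^+ j)] up to [M / 2 - M / N] commutators.  This factor
    is absorbed by the splitting of what remains of [w ^+ n], because powers of
    [w] commute.

    Lower bound: a surface of genus [k] bounded by a cyclic word
    [a_1 b_1 ... a_m b_m] in a free product of two groups is cut along the
    preimage of the wedge point into pieces lying over one factor each.  The
    gluing is a factorisation of the cyclic shift of the indices into two
    permutations, whose orbits are the boundary cycles over the two factors; an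
    orbit can bound a disc only if its label product is trivial, and is then
    called flat.  Comparing Euler characteristics, there are at least
    [m + 1 - 2 * k] flat orbits.  In [[~ a, t] ^+ n] a flat orbit either changes
    sign or has length at least the order of its letter; counting sign changes
    bounds the number of flat orbits by [n + 2 * (n %/ ord a)], while
    [m = 2 * n]. *)

(** * Products of commutators *)

Section CommutatorProducts.
Variable G : groupType.
Implicit Types (x y z g h w : G) (k l m n : nat).

Definition comm_prod k g : Prop :=
  exists2 s : seq (G * G), size s = k & \prod_(p <- s) [~ p.1, p.2] = g.

Lemma comm_prod0 : comm_prod 0 1.
Proof. by exists [::]; rewrite ?big_nil. Qed.

Lemma comm_prod1 x y : comm_prod 1 [~ x, y].
Proof. by exists [:: (x, y)]; rewrite ?big_seq1. Qed.

Lemma comm_prodM k l x y : comm_prod k x -> comm_prod l y -> comm_prod (k + l) (x * y).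
Proof. by case=> s <- <- [r <- <-]; exists (s ++ r); rewrite ?size_cat ?big_cat. Qed.

Lemma comm_prodJ k x g : comm_prod k x -> comm_prod k (x ^ g).
Proof.
case=> s <- <-; exists [seq (p.1 ^ g, p.2 ^ g) | p <- s]; first exact: size_map.
by rewrite big_map conjg_prod; apply: eq_bigr => p _; rewrite conjRg.
Qed.

Definition eq_upto k x y : Prop := comm_prod k (x / y).

Lemma eq_upto_refl x : eq_upto 0 x x.
Proof. by rewrite /eq_upto divgg; apply: comm_prod0. Qed.

Lemma eq_upto_trans k l x y z : eq_upto k x y -> eq_upto l y z -> eq_upto (k + l) x z.
Proof. by move=> xy /(comm_prodM xy); rewrite /eq_upto mulgA mulgVK. Qed.

Lemma eq_uptoJ k x y g : eq_upto k x y -> eq_upto k (x ^ g) (y ^ g).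
Proof. by rewrite /eq_upto -conjVg -conjMg; apply: comm_prodJ. Qed.

Lemma eq_uptoMr k x y g : eq_upto k x y -> eq_upto k (x * g) (y * g).
Proof. by rewrite /eq_upto mulgKA. Qed.

Lemma eq_uptoMl k x y g : eq_upto k x y -> eq_upto k (g * x) (g * y).
Proof. by rewrite [g * x]conjgCV [g * y]conjgCV => xy; apply/eq_uptoMr/eq_uptoJ. Qed.

Lemma eq_uptoM k l x x' y y' :
  eq_upto k x x' -> eq_upto l y y' -> eq_upto (k + l) (x * y) (x' * y').
Proof. by move=> xx' yy'; apply: eq_upto_trans (eq_uptoMr _ xx') (eq_uptoMl _ yy'). Qed.

Lemma eq_upto_conj x g h : eq_upto 1 (x ^ g) (x ^ h).
Proof.
rewrite /eq_upto; have -> : x ^ g / x ^ h = [~ x^-1 ^ g, g^-1 * h].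
  by rewrite /commg /conjg !gnorm.
exact: comm_prod1.
Qed.

Lemma comm_prod_upto k l x y : eq_upto k x y -> comm_prod l y -> comm_prod (k + l) x.
Proof. by move=> xy /(comm_prodM xy); rewrite mulgVK. Qed.

Lemma expgMn_upto x y m :
  eq_upto m ((x * y) ^+ m.*2.+1) (x ^+ m.*2.+1 * y ^+ m.*2.+1).
Proof.
elim: m => [|m IH]; first exact: eq_upto_refl.
rewrite doubleS -addn1; move: (m.*2.+1) IH => p IH.
have -> : (x * y) ^+ p.+2 = (x * y) ^+ p * (x * y * (x * y)).
  by rewrite -addn2 expgnDr.
apply: eq_upto_trans (eq_uptoMr _ IH) _.
have -> : x ^+ p * y ^+ p * (x * y * (x * y)) =
    x ^+ p * ((x * y * x) ^ (y ^- p) * y ^+ p.+1).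
  by rewrite expgSr /conjg !gnorm.
have -> : x ^+ p.+2 * y ^+ p.+2 = x ^+ p * ((x * y * x) ^ x^-1 * y ^+ p.+1).
  by rewrite -{1}addn2 expgnDr expgS /conjg !gnorm.
exact/eq_uptoMl/eq_uptoMr/eq_upto_conj.
Qed.

Definition split_expg w k n x y : Prop :=
  exists i, eq_upto k (w ^+ n) (x * y ^ (w ^+ i)).

(* Since [w ^+ n] commutes with [w ^+ i], conjugating the second splitting by
   [w ^+ i] makes its factor [y^-1] cancel the factor [y] of the first one. *)
Lemma split_expgM w k l m n x y z :
  split_expg w k m x y -> split_expg w l n y^-1 z -> split_expg w (k + l) (m + n) x z.
Proof.
case=> i mE [j nE]; exists (j + i).
have {nE} := eq_uptoJ (w ^+ i) nE; have /conjg_fixP -> : [~ w ^+ n, w ^+ i] == 1.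
  exact/commgP/commuteX2.
move=> /(eq_uptoM mE); rewrite -expgnDr conjMg conjVg -conjgM -expgnDr.
by rewrite mulgA mulgK.
Qed.

Lemma split_expg_iter w k n x q :
  split_expg w k n x x^-1 -> split_expg w (k * q) (n * q) x x^-1.
Proof.
move=> nE; elim: q => [|q IH].
  by exists 0; rewrite !muln0 conjg1 mulgV; apply: eq_upto_refl.
by rewrite !mulnS; apply: split_expgM nE _; rewrite invgK.
Qed.

Lemma split_expgC w k n x y z :
  commute x w -> commute y z -> split_expg (w * z) k n x y -> split_expg (z * w) k n x y.
Proof.
move=> xw yz [i nE]; exists i.+1; have {nE} := eq_uptoJ w nE.
have zwE : z * w = (w * z) ^ w by rewrite /conjg mulgA mulKg.
rewrite conjXg -zwE conjMg -conjgM.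
have /conjg_fixP -> : [~ x, w] == 1 by apply/commgP.
suff -> : y ^ ((w * z) ^+ i * w) = y ^ ((z * w) ^+ i.+1) by [].
have -> : (w * z) ^+ i * w = w * (z * w) ^+ i by rewrite zwE -conjXg -conjgC.
rewrite expgS -mulgA [in RHS]conjgM.
by have /conjg_fixP -> : [~ y, z] == 1 by apply/commgP.
Qed.

Lemma comm_prod_split w k n x g : split_expg w k n x (x^-1 ^ g) -> comm_prod k.+1 (w ^+ n).
Proof.
case=> i nE; rewrite -addn1; apply: comm_prod_upto nE _.
by rewrite -conjgM conjVg -{1}[x]conjg1; apply: eq_upto_conj.
Qed.

End CommutatorProducts.

Section SplitPowers.
Variable G : groupType.
Implicit Types (x y z : G) (e k l m n r : nat).

Lemma split_expg_odd x y m :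
  split_expg (x * y) m m.*2.+1 (x ^+ m.*2.+1) (y ^+ m.*2.+1).
Proof. by exists 0; rewrite conjg1; apply: expgMn_upto. Qed.

Lemma expg_invX2 x m : x ^+ m.+2 = 1 -> x ^+ m = x ^- 2.
Proof. by move=> xN; apply/esym/mulg1_eq; rewrite -expgnDr. Qed.

(* Splitting the odd powers of [x * y] leaves the factor [x ^- 2 * y ^- 2 * x],
   which like [x * (x * y) ^- 2] is a conjugate of [y ^- 2 * x^-1]. *)
Lemma split_expg_odd_order x y m r :
    x ^+ m.*2.+3 = 1 -> y ^+ m.*2.+3 = 1 ->
  split_expg (x * y) (m + r).+1 (m.*2.+3 + r.*2.+2) (x ^+ r.*2.+2) (y ^+ r.*2.+2).
Proof.
move=> xN yN; exists 2; set w := x * y.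
have -> : w ^+ (m.*2.+3 + r.*2.+2) = w ^+ r.*2.+1 * w ^+ m.*2.+1 * w * w ^+ 2.
  by rewrite -expgnDr -expgSr -expgnDr; congr (_ ^+ _); lia.
have -> : x ^+ r.*2.+2 * y ^+ r.*2.+2 ^ (w ^+ 2) =
    x ^+ r.*2.+1 * ((y ^- 2 * x^-1) ^ (y^-1 * x^-1) * y ^+ r.*2.+2) * w ^+ 2.
  by rewrite (expgSr x) /conjg /w !expg2 !gnorm.
have -> : (m + r).+1 = (r + m + 1)%N by lia.
apply/eq_uptoMr/eq_upto_trans.
  by apply/eq_uptoMr/eq_uptoM; apply: expgMn_upto.
have -> : x ^+ r.*2.+1 * y ^+ r.*2.+1 * (x ^+ m.*2.+1 * y ^+ m.*2.+1) * w =
    x ^+ r.*2.+1 * ((y ^- 2 * x^-1) ^ (x ^+ 2 * y ^- r.*2.+1) * y ^+ r.*2.+2).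
  by rewrite (expg_invX2 xN) (expg_invX2 yN) (expgSr y r.*2.+1) /conjg /w !expg2 !gnorm.
exact/eq_uptoMl/eq_uptoMr/eq_upto_conj.
Qed.

Lemma split_expg_period x y N k l m n e :
    x ^+ N = 1 -> y ^+ N = 1 -> e <= N ->
    split_expg (x * y) k m (x ^+ e) (y ^+ e) ->
    split_expg (y * x) l n (y ^+ (N - e)) (x ^+ (N - e)) ->
  split_expg (x * y) (k + l) (m + n) (x ^+ e) (x ^- e).
Proof.
move=> xN yN leN xyE; rewrite !expgnFr // xN yN !mul1g => /split_expgC yxE.
apply: split_expgM xyE (yxE _ _); exact/commute_sym/commuteV/commuteX.
Qed.

Lemma split_expg_even_period x y m r : x ^+ m.*2.+2 = 1 -> y ^+ m.*2.+2 = 1 -> r <= m ->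
  split_expg (x * y) m m.*2.+2 (x ^+ r.*2.+1) (x ^- r.*2.+1).
Proof.
move=> xN yN le_rm.
have -> : m.*2.+2 = (r.*2.+1 + (m - r).*2.+1)%N by lia.
have {1}-> : m = (r + (m - r))%N by lia.
apply: (split_expg_period xN yN _ (split_expg_odd _ _ _)); first by lia.
have -> : (m.*2.+2 - r.*2.+1 = (m - r).*2.+1)%N by lia.
exact: split_expg_odd.
Qed.

Lemma split_expg_odd_period x y m e :
    x ^+ m.*2.+3 = 1 -> y ^+ m.*2.+3 = 1 -> 0 < e < m.*2.+3 ->
  split_expg (x * y) m.*2.+1 (m.*2.+3).*2 (x ^+ e) (x ^- e).
Proof.
move=> xN yN; rewrite -[e]odd_double_half; case: (odd e); last case: (e./2) => [//|r] ltN.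
- move: (e./2) => r ltN.
  have -> : (m.*2.+3).*2 = (r.*2.+1 + (m.*2.+3 + (m - r).*2.+2))%N by lia.
  have {1}-> : m.*2.+1 = (r + (m + (m - r)).+1)%N by lia.
  apply: (split_expg_period xN yN _ (split_expg_odd _ _ _)); first by lia.
  have -> : (m.*2.+3 - (true + r.*2) = (m - r).*2.+2)%N by lia.
  exact: split_expg_odd_order yN xN.
- have -> : (m.*2.+3).*2 = (m.*2.+3 + r.*2.+2 + (m - r).*2.+1)%N by lia.
  have {1}-> : m.*2.+1 = ((m + r).+1 + (m - r))%N by lia.
  apply: (split_expg_period xN yN _ (split_expg_odd_order _ xN yN)); first by lia.
  have -> : (m.*2.+3 - (false + r.+1.*2) = (m - r).*2.+1)%N by lia.
  exact: split_expg_odd.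
Qed.

End SplitPowers.

Section CommutatorPowers.
Variables (G : groupType) (a t : G).
Implicit Types (k l m n q r : nat).

Lemma conj_expg_eq1 N : a ^+ N = 1 -> (a ^ t) ^+ N = 1.
Proof. by move=> aN; rewrite -conjXg aN conj1g. Qed.

Lemma conj_expgV n : (a ^ t) ^+ n = (a^-1 ^+ n)^-1 ^ t.
Proof. by rewrite expVgn invgK conjXg. Qed.

Lemma comm_prod_split_commX k n e :
  split_expg [~ a, t] k n (a^-1 ^+ e) ((a ^ t) ^+ e) -> comm_prod k.+1 ([~ a, t] ^+ n).
Proof. by rewrite conj_expgV; apply: comm_prod_split. Qed.

Lemma comm_prod_odd_commX m : comm_prod m.+1 ([~ a, t] ^+ m.*2.+1).
Proof. exact: comm_prod_split_commX (split_expg_odd _ _ m). Qed.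

Lemma comm_prod_commX n : 0 < n -> comm_prod n./2.+1 ([~ a, t] ^+ n).
Proof.
rewrite -[n]odd_double_half; case: (odd n); last case: (n./2) => // m _.
  by rewrite half_bit_double => _; apply: comm_prod_odd_commX.
rewrite half_bit_double doubleS expgS -[m.+2]add1n.
by apply: comm_prodM; [apply: comm_prod1 | apply: comm_prod_odd_commX].
Qed.

Lemma comm_prod_commX_period k l m n e q :
    split_expg [~ a, t] k m (a^-1 ^+ e) (a^-1 ^- e) ->
    split_expg [~ a, t] l n (a^-1 ^+ e) ((a ^ t) ^+ e) ->
  comm_prod (k * q + l).+1 ([~ a, t] ^+ (m * q + n)).
Proof.
move=> /(split_expg_iter q) mE nE; apply: (@comm_prod_split_commX _ _ e).
by apply: split_expgM mE _; rewrite invgK.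
Qed.

Lemma comm_prod_commX_even_order m q r : a ^+ m.*2.+2 = 1 -> r <= m ->
  comm_prod (m * q + r).+1 ([~ a, t] ^+ (m.*2.+2 * q + r.*2.+1)).
Proof.
move=> aN ler; have vN : a^-1 ^+ m.*2.+2 = 1 by rewrite expVgn aN invg1.
apply: comm_prod_commX_period (split_expg_odd _ _ _).
exact: split_expg_even_period vN (conj_expg_eq1 aN) ler.
Qed.

Lemma comm_prod_commX_odd_order_lt m q r : a ^+ m.*2.+3 = 1 -> r <= m ->
  comm_prod (m.*2.+1 * q + r).+1 ([~ a, t] ^+ ((m.*2.+3).*2 * q + r.*2.+1)).
Proof.
move=> aN ler; have vN : a^-1 ^+ m.*2.+3 = 1 by rewrite expVgn aN invg1.
apply: comm_prod_commX_period (split_expg_odd _ _ _).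
by apply: split_expg_odd_period vN (conj_expg_eq1 aN) _; lia.
Qed.

Lemma comm_prod_commX_odd_order_eq m q : a ^+ m.*2.+3 = 1 ->
  comm_prod (m.*2.+1 * q + m).+1 ([~ a, t] ^+ ((m.*2.+3).*2 * q + m.*2.+3)).
Proof.
move=> aN; set w := [~ a, t]; set c := a ^ t; have cN := conj_expg_eq1 aN.
have vN : a^-1 ^+ m.*2.+3 = 1 by rewrite expVgn aN invg1.
have /(split_expg_iter q) qE : split_expg w m.*2.+1 (m.*2.+3).*2 a^-1 a^-1^-1.
  by have := split_expg_odd_period vN cN (isT : 0 < 1 < m.*2.+3).
have mE : split_expg w m m.*2.+2 a^-1^-1^-1 (c * (a ^+ 2 * c ^- 2)).
  exists 0; rewrite conjg1 invgK expgS -mulgA; apply: eq_uptoMl; apply: eq_uptoMl.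
  have -> : a ^+ 2 * c ^- 2 = a^-1 ^+ m.*2.+1 * c ^+ m.*2.+1.
    by rewrite (expg_invX2 vN) (expg_invX2 cN) expVgn invgK.
  exact: expgMn_upto.
have [i {mE} E] := split_expgM qE mE.
rewrite addnS expgS -addn1; apply: comm_prod_upto (eq_uptoMl w E) _.
have -> : w * (a^-1 * (c * (a ^+ 2 * c ^- 2)) ^ (w ^+ i)) =
    (c * a^-1 ^+ 2) ^ a / (c * a^-1 ^+ 2) ^ (c^-1 * w ^+ i).
  by rewrite /w /commg -/c !expg2 /conjg !gnorm.
exact: eq_upto_conj.
Qed.

Lemma comm_prod_commX_odd_order_gt m q r : a ^+ m.*2.+3 = 1 -> r <= m ->
  comm_prod (m.*2.+1 * q + (m + r).+1).+1
    ([~ a, t] ^+ ((m.*2.+3).*2 * q + (m.*2.+3 + r.*2.+2))).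
Proof.
move=> aN ler; have vN : a^-1 ^+ m.*2.+3 = 1 by rewrite expVgn aN invg1.
have cN := conj_expg_eq1 aN.
apply: comm_prod_commX_period (split_expg_odd_order _ vN cN).
by apply: split_expg_odd_period vN cN _; lia.
Qed.

Lemma comm_prod_commX_multiple k m e q :
    split_expg [~ a, t] k m (a^-1 ^+ e) (a^-1 ^- e) ->
  comm_prod (k * q).+1 ([~ a, t] ^+ (m * q)).
Proof.
move=> /(split_expg_iter q) mE; apply: (@comm_prod_split _ _ _ _ (a^-1 ^+ e) 1).
by rewrite conjg1.
Qed.

Lemma comm_prod_commX_odd N n : 1 < N -> a ^+ N = 1 -> odd n ->
  comm_prod (n./2 - n %/ N).+1 ([~ a, t] ^+ n).
Proof.
move=> N1 aN on; have := divn_eq n N; have := ltn_pmod n (ltnW N1).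
move: (n %/ N) (n %% N) => q r ltr nE; have [eN|oN] := boolP (~~ odd N).
  have [m NE] : exists m, N = m.*2.+2 by exists N.-2./2; lia.
  subst N; have [p rE] : exists p, r = p.*2.+1 by exists r./2; lia.
  subst r; have -> : (n./2 - q = m * q + p)%N by lia.
  have -> : n = (m.*2.+2 * q + p.*2.+1)%N by lia.
  by apply: comm_prod_commX_even_order aN _; lia.
have [m NE] : exists m, N = m.*2.+3 by exists (N - 3)./2; lia.
subst N; have [eq|oq] := boolP (~~ odd q).
  have [p qE] : exists p, q = p.*2 by exists q./2; lia.
  subst q; have [u rE] : exists u, r = u.*2.+1 by exists r./2; lia.
  subst r; have -> : (n./2 - p.*2 = m.*2.+1 * p + u)%N by lia.
  have -> : n = ((m.*2.+3).*2 * p + u.*2.+1)%N by lia.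
  by apply: comm_prod_commX_odd_order_lt aN _; lia.
have [p qE] : exists p, q = p.*2.+1 by exists q./2; lia.
subst q; have [r0|r0] := eqVneq r 0.
  subst r; have -> : (n./2 - p.*2.+1 = m.*2.+1 * p + m)%N by lia.
  have -> : n = ((m.*2.+3).*2 * p + m.*2.+3)%N by lia.
  exact: comm_prod_commX_odd_order_eq.
have [u rE] : exists u, r = u.*2.+2 by exists r.-2./2; lia.
subst r; have -> : (n./2 - p.*2.+1 = m.*2.+1 * p + (m + u).+1)%N by lia.
have -> : n = ((m.*2.+3).*2 * p + (m.*2.+3 + u.*2.+2))%N by lia.
by apply: comm_prod_commX_odd_order_gt aN _; lia.
Qed.

Lemma comm_prod_commX_dvdn N n : 1 < N -> a ^+ N = 1 -> ~~ odd n -> N %| n ->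
  comm_prod (n./2 - n %/ N).+1 ([~ a, t] ^+ n).
Proof.
move=> N1 aN en /dvdnP[q nE]; subst n; rewrite mulnK ?(ltnW N1) //.
have vN : a^-1 ^+ N = 1 by rewrite expVgn aN invg1.
have cN := conj_expg_eq1 aN; have [eN|oN] := boolP (~~ odd N).
  have [m NE] : exists m, N = m.*2.+2 by exists N.-2./2; lia.
  subst N; have -> : ((q * m.*2.+2)./2 - q = m * q)%N by lia.
  rewrite [(q * _)%N]mulnC.
  exact: comm_prod_commX_multiple (split_expg_even_period vN cN (leq0n m)).
have [m NE] : exists m, N = m.*2.+3 by exists (N - 3)./2; lia.
subst N; have [p qE] : exists p, q = p.*2 by exists q./2; lia.
subst q; have -> : ((p.*2 * m.*2.+3)./2 - p.*2 = m.*2.+1 * p)%N by lia.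
have -> : (p.*2 * m.*2.+3 = (m.*2.+3).*2 * p)%N by lia.
exact: comm_prod_commX_multiple (split_expg_odd_period vN cN (isT : 0 < 1 < m.*2.+3)).
Qed.

Lemma comm_prod_commX_gt1 N n : 1 < N -> a ^+ N = 1 -> 0 < n ->
  comm_prod (n./2 - n %/ N).+1 ([~ a, t] ^+ n).
Proof.
move=> N1 aN n0; have [on|en] := boolP (odd n); first exact: comm_prod_commX_odd.
have [Nn|nNn] := boolP (N %| n); first exact: comm_prod_commX_dvdn.
case: n n0 en nNn => // n _ /= en nNn.
have divE : n.+1 %/ N = n %/ N by rewrite divnS ?(ltnW N1) // (negPf nNn).
have -> : (uphalf n - n.+1 %/ N).+1 = (1 + (n./2 - n %/ N).+1)%N.
  by have := leq_div2l n (isT : 0 < 2) N1; rewrite divE divn2; lia.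
rewrite expgS; apply: comm_prodM; first exact: comm_prod1.
by apply: comm_prod_commX_odd => //; lia.
Qed.

(* For [N = 0] the quotient [n %/ N] is [0]: this covers infinite order. *)
Theorem comm_prod_commX_order (N n : nat) : N != 1%N -> a ^+ N = 1 -> 0 < n ->
  comm_prod (n./2 - n %/ N).+1 ([~ a, t] ^+ n).
Proof.
case: N => [_ _|[//|N] _ aN]; last exact: comm_prod_commX_gt1.
by rewrite divn0 subn0; apply: comm_prod_commX.
Qed.

End CommutatorPowers.

(** * Flat orbits of a labelled permutation *)

Lemma leq_card_trivIset (T : finType) (P Q : {set {set T}}) :
    trivIset P -> set0 \notin Q ->
    (forall C, C \in P -> exists2 D, D \in Q & D \subset C) ->
  #|P| <= #|Q|.
Proof.
move=> /trivIsetP tP nQ PQ; pose f (C : {set T}) := odflt C [pick D in Q | D \subset C].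
have fP C : C \in P -> f C \in Q /\ f C \subset C.
  move=> /PQ[D DQ DC]; rewrite /f; case: pickP => [E /andP[]//|/(_ D)].
  by rewrite DQ DC.
rewrite -(card_in_imset (f := f)) => [|C C' CP C'P eqf].
  by apply/subset_leq_card/subsetP => _ /imsetP[C /fP[fQ _] ->].
have [fQ fC] := fP C CP; have [_ fC'] := fP C' C'P.
have /set0Pn[z zf] : f C != set0 by apply: contraNneq nQ => <-.
apply: contraTeq (subsetP fC z zf) => /(tP _ _ CP C'P)/disjointFl-> //.
by rewrite (subsetP fC') // -eqf.
Qed.

Section Porbits.
Variable I : finType.
Implicit Types (s : {perm I}) (x y z i : I) (C : {set I}).

Lemma porbit_step s x i : (s i \in porbit s x) = (i \in porbit s x).
Proof. by rewrite -[s i]/((s ^+ 1) i) !(porbit_sym s _ x) porbit_perm. Qed.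

Lemma porbit_ind s x (P : I -> Prop) :
  P x -> (forall i, P i -> P (s i)) -> {in porbit s x, forall i, P i}.
Proof.
move=> Px Ps i /porbitP[k ->]; elim: k => [|k IH]; first by rewrite perm1.
by rewrite expgSr permM; apply: Ps.
Qed.

Lemma porbits_mem s C x : C \in porbits s -> x \in C -> C = porbit s x.
Proof. by case/imsetP=> z _ -> xC; apply/eqP; rewrite eq_sym eq_porbit_mem. Qed.

Lemma porbits_closed s C i : C \in porbits s -> (s i \in C) = (i \in C).
Proof. by case/imsetP=> z _ ->; apply: porbit_step. Qed.

Lemma trivIset_porbits s : trivIset (porbits s).
Proof.
apply/trivIsetP => C D Cs Ds; apply: contraNT => /pred0Pn[z /andP[/= zC zD]].
by rewrite (porbits_mem Cs zC) (porbits_mem Ds zD).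
Qed.

Lemma set0_porbits s : set0 \notin porbits s.
Proof. by apply/imsetP => -[z _ C0]; have := porbit_id s z; rewrite -C0 inE. Qed.

Lemma porbit_fix s x : s x = x -> porbit s x = [set x].
Proof.
move=> sx; apply/setP => i; rewrite inE; apply/idP/eqP => [|->]; last exact: porbit_id.
by move: i; apply: porbit_ind => // i ->.
Qed.

Lemma eq_in_porbits s s' C : C \in porbits s -> {in C, s =1 s'} -> C \in porbits s'.
Proof.
move=> Cs eqs; have /imsetP[z _ CE] := Cs; apply/imsetP; exists z => //.
have eqX k : (s ^+ k) z = (s' ^+ k) z.
  by elim: k => [|k IH]; rewrite ?perm1 // !expgSr !permM -IH eqs // CE mem_porbit.
by rewrite CE; apply/setP => i; apply/porbitP/porbitP => -[k ->]; exists k.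
Qed.

End Porbits.

Section FlatOrbits.
Variables (G : groupType) (I : finType).
Implicit Types (s : {perm I}) (lab g h : I -> G) (x y i : I) (C D : {set I}).

(* The product of the labels along an orbit is trivial if and only if the labels
   have a potential, which does not require the choice of a base point. *)
Definition flat s lab C : bool :=
  `[< exists h, {in C, forall i, h (s i) = h i * lab i} >].

Definition flat_porbits s lab : {set {set I}} := [set C in porbits s | flat s lab C].

Lemma flat_porbitsP s lab C :
  reflect (C \in porbits s /\ exists h, {in C, forall i, h (s i) = h i * lab i})
    (C \in flat_porbits s lab).
Proof. by rewrite inE; apply: (iffP andP) => -[Cs /asboolP]. Qed.

Lemma trivIset_flat_porbits s lab : trivIset (flat_porbits s lab).
Proof. by apply: trivIsetS (trivIset_porbits s); apply/subsetP => C /setIdP[]. Qed.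

Lemma eq_in_flat_porbits s s' lab C :
  C \in flat_porbits s lab -> {in C, s =1 s'} -> C \in flat_porbits s' lab.
Proof.
move=> /flat_porbitsP[Cs [h hP]] eqs; apply/flat_porbitsP.
split; first exact: eq_in_porbits eqs.
by exists h => i iC; rewrite -eqs // hP.
Qed.

Lemma flat_porbits_gauge s lab g :
  flat_porbits s (fun i => (g i)^-1 * lab i * g (s i)) = flat_porbits s lab.
Proof.
apply/setP => C; rewrite !inE; congr (_ && _); apply/asboolP/asboolP => -[h hP].
- by exists (fun i => h i * (g i)^-1) => i iC /=; rewrite hP // !mulgA mulgK.
- by exists (fun i => h i * g i) => i iC /=; rewrite hP // !mulgA mulgK.
Qed.

Lemma flat_porbitsV s lab : flat_porbits s^-1 (fun i => (lab i)^-1) = flat_porbits s lab.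
Proof.
apply/setP => C; rewrite !inE porbitsV; apply: andb_id2l => Cs.
apply/asboolP/asboolP => -[h hP].
- by exists (h \o s^-1) => i iC /=; rewrite permK hP // mulgVK.
- by exists (h \o s) => i iC /=; rewrite permKV hP // mulgK.
Qed.

Lemma flat_porbits_fix s lab x : s x = x -> lab x = 1 -> [set x] \in flat_porbits s lab.
Proof.
move=> sx lx; apply/flat_porbitsP; split; first by rewrite -(porbit_fix sx) imset_f.
by exists (fun=> 1) => i; rewrite inE => /eqP ->; rewrite lx mulg1.
Qed.

Lemma flat_porbits1 : flat_porbits 1 (fun=> 1) = [set [set i] | i : I].
Proof.
apply/setP => C; apply/setIdP/imsetP => [[/imsetP[i _ ->] _]|[i _ ->]].
  by exists i; rewrite // porbit_fix ?perm1.
by apply/setIdP; apply: flat_porbits_fix; rewrite ?perm1.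
Qed.

Definition nflat s lab : nat := #|flat_porbits s lab|.

Lemma nflat1 : nflat 1 (fun=> 1) = #|I|.
Proof. by rewrite /nflat flat_porbits1 card_imset //; apply: set1_inj. Qed.

Lemma nflat_slide s lab lab' x y :
    s x = y -> x != y -> lab' x * lab' y = lab x * lab y ->
    (forall i, i != x -> i != y -> lab' i = lab i) ->
  nflat s lab' = nflat s lab.
Proof.
move=> sx nxy labxy eql; pose g := [eta fun=> 1 with y |-> (lab x)^-1 * lab' x].
rewrite /nflat -(flat_porbits_gauge s lab g); congr #|pred_of_set (flat_porbits s _)|.
apply/funext => i; rewrite /= -{2}sx (inj_eq perm_inj).
have [->|nix] := eqVneq i x; first by rewrite (negPf nxy) invg1 mul1g mulVKg.
have [->|niy] := eqVneq i y; last by rewrite invg1 mul1g mulg1 eql.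
by rewrite mulg1 invgM invgK -mulgA -labxy mulKg.
Qed.

Lemma flat_porbits_tperm s lab x y C :
    C \in flat_porbits s lab -> C != porbit s x -> C != porbit s y ->
  [/\ C \in flat_porbits (tperm x y * s) lab, x \notin C & y \notin C].
Proof.
move=> gC Cx Cy; have /flat_porbitsP[Cs _] := gC.
have xC : x \notin C by apply: contra Cx => /(porbits_mem Cs) ->.
have yC : y \notin C by apply: contra Cy => /(porbits_mem Cs) ->.
split=> //; apply: eq_in_flat_porbits gC _ => i iC; rewrite permM.
by rewrite tpermD //; [apply: contraNneq xC | apply: contraNneq yC] => ->.
Qed.

Lemma flat_porbits_merge s lab x y : porbit s x != porbit s y ->
    porbit s x \in flat_porbits s lab -> porbit s y \in flat_porbits s lab ->
  porbit (tperm x y * s) x \in flat_porbits (tperm x y * s) lab.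
Proof.
move=> nxy /flat_porbitsP[_ [hx hxP]] /flat_porbitsP[_ [hy hyP]].
set s' := tperm x y * s; set Cx := porbit s x; set Cy := porbit s y.
have s'x : s' x = s y by rewrite permM tpermL.
have s'y : s' y = s x by rewrite permM tpermR.
have xCx : x \in Cx := porbit_id s x; have yCy : y \in Cy := porbit_id s y.
have disj i : i \in Cy -> i \in Cx = false.
  have := trivIsetP (trivIset_porbits s) _ _ (imset_f _ isT) (imset_f _ isT) nxy.
  exact: disjointFl.
have sub : {in porbit s' x, forall i, (i \in Cx) || (i \in Cy)}.
  apply: porbit_ind => [|i]; first by rewrite xCx.
  by rewrite permM; case: tpermP => [->|->|_ _]; rewrite !porbit_step ?xCx ?yCy ?orbT.
pose c := hx x * lab x * (hy y * lab y)^-1.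
apply/flat_porbitsP; split; first exact: imset_f.
exists (fun i => if i \in Cx then hx i else c * hy i) => i /sub.
have [->|nix] := eqVneq i x.
  by rewrite xCx s'x disj ?porbit_step // hyP // mulgVK.
have [->|niy] := eqVneq i y.
  by rewrite (disj _ yCy) s'y porbit_step xCx hxP // -mulgA mulgVK.
rewrite permM tpermD 1?eq_sym // porbit_step; case: ifP => [iC _|_ /= iC]; first by rewrite hxP.
by rewrite hyP // mulgA.
Qed.

Lemma nflat_tpermM s lab x y : nflat s lab <= (nflat (tperm x y * s) lab).+1.
Proof.
rewrite /nflat; set P := flat_porbits s lab; set Q := flat_porbits _ lab.
set Cx := porbit s x; set Cy := porbit s y.
have PQ C : C \in P -> C != Cx -> C != Cy -> C \in Q.
  by move=> CP Cx' Cy'; have [] := flat_porbits_tperm CP Cx' Cy'.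
have [/and3P[CxP CyP nxy]|] := boolP [&& Cx \in P, Cy \in P & Cx != Cy].
- rewrite (cardsD1 Cx) CxP (cardsD1 Cy) in_setD1 eq_sym nxy CyP !add1n ltnS.
  rewrite (cardsD1 (porbit (tperm x y * s) x) Q) (flat_porbits_merge nxy CxP CyP) ltnS.
  apply: subset_leq_card; apply/subsetP => C; rewrite !in_setD1 => /and3P[Cy' Cx' CP].
  have [-> xC _] := flat_porbits_tperm CP Cx' Cy'; rewrite andbT.
  by apply: contraNneq xC => ->; apply: porbit_id.
- move=> nP; suff [X /subset_leq_card sub] : exists X, P \subset X |: Q.
    by apply: leq_trans sub _; rewrite cardsU1 -add1n leq_add2r leq_b1.
  exists (if Cx \in P then Cx else Cy); apply/subsetP => C CP.
  rewrite in_setU1 -implyNb; apply/implyP => CX.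
  apply: (PQ _ CP); apply: contraNneq CX => CE; first by rewrite -CE CP.
  by rewrite CE in CP *; case: ifP nP => // _; rewrite CP /= negbK eq_sym.
Qed.

Lemma nflatM_tperm s lab x y : nflat s lab <= (nflat (s * tperm x y) lab).+1.
Proof.
by rewrite -[x](permKV s) -[y](permKV s) -tpermJ -conjgC nflat_tpermM.
Qed.

Lemma nflat_cut s lab x : s x != x -> lab x = 1 ->
  nflat s lab < nflat (s * tperm x (s x)) lab.
Proof.
move=> sx lx; set s' := s * _.
have s'x : s' x = x by rewrite permM tpermR.
have s'E i : i != x -> s' i = if s i == x then s x else s i.
  move=> nix; rewrite permM; have [->|nsi] := eqVneq (s i) x; first by rewrite tpermL.
  by rewrite tpermD // 1?eq_sym // (inj_eq perm_inj).
rewrite /nflat (cardsD1 [set x] (flat_porbits s' lab)) flat_porbits_fix // add1n ltnS.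
apply: leq_card_trivIset (trivIset_flat_porbits s lab) _ _ => [|C].
  by apply: contra (set0_porbits s') => /setD1P[_ /setIdP[]].
move=> /flat_porbitsP[Cs [h hP]].
have [y yC nyx] : exists2 y, y \in C & y != x.
  have /imsetP[z _ CE] := Cs; have [zx|nzx] := eqVneq z x.
    by exists (s x); rewrite // (porbits_closed _ Cs) CE zx porbit_id.
  by exists z => //; rewrite CE porbit_id.
have sub : {in porbit s' y, forall i, i \in C}.
  apply: porbit_ind => // i iC; have [ix|nix] := eqVneq i x; first by rewrite ix s'x -ix.
  by rewrite s'E //; case: eqP => [<-|_]; rewrite !(porbits_closed _ Cs).
exists (porbit s' y); last exact/subsetP.
rewrite in_setD1; apply/andP; split.
  by apply: contraNneq nyx => Dx; rewrite -in_set1 -Dx porbit_id.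
apply/flat_porbitsP; split; first exact: imset_f.
exists h => i /sub iC; have [->|nix] := eqVneq i x; first by rewrite s'x lx mulg1.
rewrite s'E //; have [six|_] := eqVneq (s i) x; last exact: hP.
have xC : x \in C by rewrite -six (porbits_closed _ Cs).
by rewrite hP // lx mulg1 -six hP.
Qed.

End FlatOrbits.

(** * Diagrams *)

Section CyclePerm.
Variable I : finType.
Implicit Types (x y z : I) (e p q r u v : seq I).

Fixpoint cycle_perm e : {perm I} :=
  if e is x :: p then cycle_perm p * tperm x (head x p) else 1.

Lemma cycle_perm1 x : cycle_perm [:: x] = 1.
Proof. by rewrite /= tperm1 mulg1. Qed.

Lemma cycle_perm_cat u x y v :
  cycle_perm (rcons u x ++ y :: v) =
  cycle_perm (y :: v) * tperm x y * cycle_perm (rcons u x).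
Proof.
elim: u => [|z u IH]; first by rewrite [rcons _ _]/= cycle_perm1 mulg1.
by rewrite rcons_cons cat_cons [LHS]/= [RHS]/= IH -!mulgA; case: (u).
Qed.

Lemma cycle_perm_on e : perm_on [set x in e] (cycle_perm e).
Proof.
elim: e => [|x [|y p] IH]; first exact: perm_on1.
  by rewrite cycle_perm1 perm_on1.
apply: perm_onM; [apply: subset_trans IH _|apply: subset_trans (tperm_on x y) _].
  by apply/subsetP => z; rewrite !inE => ->; rewrite orbT.
by apply/subsetP => z; rewrite !inE orbA => ->.
Qed.

Lemma cycle_perm_out e x : x \notin e -> cycle_perm e x = x.
Proof. by move=> xe; apply: out_perm (cycle_perm_on e) _; rewrite inE. Qed.

Lemma cycle_perm_last x p : cycle_perm (x :: p) (last x p) = x.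
Proof.
elim: p x => [|y p IH] x; first by rewrite cycle_perm1 perm1.
by rewrite permM IH tpermR.
Qed.

Lemma cycle_perm_succ p x y q : uniq (p ++ [:: x, y & q]) ->
  cycle_perm (p ++ [:: x, y & q]) x = y.
Proof.
rewrite -cat_rcons cat_uniq => /and3P[_ /hasPn dis /andP[yq _]].
rewrite cycle_perm_cat 2!permM [cycle_perm (y :: q) x]cycle_perm_out ?tpermL.
  by rewrite cycle_perm_out // dis ?mem_head.
by apply/negP => /dis; rewrite /= mem_rcons mem_head.
Qed.

Lemma cycle_perm_next e x : uniq e -> cycle_perm e x = next e x.
Proof.
have [|xe] := boolP (x \in e); last by rewrite cycle_perm_out // next_nth (negPf xe).
case/splitPr=> p [|y q] Ue; rewrite -(next_rot (size p) Ue) rot_size_cat; last first.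
  by rewrite cycle_perm_succ //= eqxx.
case: p {Ue} => [|z p]; first by rewrite cycle_perm1 perm1 /= eqxx.
by rewrite [RHS]/= eqxx cats1 -{2}(last_rcons z p x) cycle_perm_last.
Qed.

Lemma cycle_perm_rev e : cycle_perm (rev e) = (cycle_perm e)^-1.
Proof.
elim: e => [|x [|y p] IH]; first by rewrite invg1.
  by rewrite cycle_perm1 invg1.
rewrite !rev_cons -cats1 cycle_perm_cat -rev_cons IH cycle_perm1 mul1g.
by rewrite [RHS]invgM tpermV tpermC.
Qed.

Lemma commute_cycle_perm u v : uniq (u ++ v) -> commute (cycle_perm u) (cycle_perm v).
Proof.
rewrite cat_uniq => /and3P[_ /hasPn dis _].
apply: perm_onC (cycle_perm_on u) (cycle_perm_on v) _.
by rewrite disjoint_sym; apply/pred0P => z /=; rewrite !inE; apply/andP => -[/dis/negP].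
Qed.

Lemma cycle_perm_merge u x v y : uniq (rcons u x ++ rcons v y) ->
  cycle_perm (rcons u x ++ rcons v y) =
  tperm x y * (cycle_perm (rcons u x) * cycle_perm (rcons v y)).
Proof.
move=> Ue; have := Ue; rewrite cat_uniq => /and3P[_ /hasPn dis _].
have [z [w wE]] : exists z w, rcons v y = z :: w.
  by exists (head y v), (behead (rcons v y)); rewrite headI.
have zy : cycle_perm (rcons v y) y = z.
  by rewrite wE -(last_rcons z v y) wE cycle_perm_last.
have xfix : cycle_perm (rcons v y) x = x.
  by apply: cycle_perm_out; apply/negP => /dis; rewrite /= mem_rcons mem_head.
rewrite (commute_cycle_perm Ue) mulgA {1}wE cycle_perm_cat -wE; congr (_ * _).
by rewrite [RHS]conjgC tpermJ xfix zy.
Qed.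

Lemma cycle_perm_catC u v : uniq (u ++ v) -> cycle_perm (v ++ u) = cycle_perm (u ++ v).
Proof.
case/lastP: u => [|u x]; first by rewrite cats0.
case/lastP: v => [|v y]; first by rewrite cats0.
move=> Ue; rewrite !cycle_perm_merge // 1?uniq_catC //.
by rewrite tpermC (commute_cycle_perm Ue).
Qed.

Lemma cycle_perm_merge3 p x q y r z : uniq (rcons p x ++ rcons q y ++ rcons r z) ->
  cycle_perm (rcons p x ++ rcons q y ++ rcons r z) =
  tperm x z * tperm y z *
    (cycle_perm (rcons p x) * cycle_perm (rcons q y) * cycle_perm (rcons r z)).
Proof.
move=> Ue; have := Ue; rewrite cat_uniq => /and3P[_ /hasPn dis Uqr].
have fixP w : w \in rcons q y ++ rcons r z -> cycle_perm (rcons p x) w = w.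
  by move/dis; apply: cycle_perm_out.
have tP : commute (tperm y z) (cycle_perm (rcons p x)).
  by rewrite /commute conjgC tpermJ !fixP // mem_cat !mem_rcons !mem_head ?orbT.
rewrite -rcons_cat cycle_perm_merge ?rcons_cat // cycle_perm_merge //.
rewrite -!mulgA; congr (_ * _); rewrite [RHS]mulgA tP; exact: mulgA.
Qed.

Lemma cycle_perm_swap p x q y r z : uniq (rcons p x ++ rcons q y ++ rcons r z) ->
  cycle_perm (rcons q y ++ rcons p x ++ rcons r z) =
  tperm x y * (tperm x z * cycle_perm (rcons p x ++ rcons q y ++ rcons r z)).
Proof.
move=> Ue; have Uqp : uniq (rcons q y ++ rcons p x ++ rcons r z).
  by rewrite uniq_catCA.
have xN : x \notin rcons q y ++ rcons r z.
  move: Ue; rewrite cat_uniq => /and3P[_ /hasPn dis _].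
  by apply/negP => /dis; rewrite /= mem_rcons mem_head.
have cPQ : commute (cycle_perm (rcons p x)) (cycle_perm (rcons q y)).
  by apply: commute_cycle_perm; move: Ue; rewrite catA cat_uniq => /and3P[].
rewrite !cycle_perm_merge3 // [in RHS]cPQ !mulgA -[tperm x y * _ * _]mulgA tperm2 mulg1.
congr (_ * _ * _ * _); rewrite conjgCV tpermV tpermJ tpermR tpermD //.
- by apply: contraNneq xN => <-; rewrite mem_cat mem_rcons mem_head.
- by apply: contraNneq xN => <-; rewrite mem_cat !mem_rcons mem_head orbT.
Qed.

End CyclePerm.

Section Diagrams.
Variables A B : groupType.
Implicit Types (W u v : seq (A * B)) (k N : nat).

(* A surface of genus [k] bounded by a cyclic word is cut along the preimage of
   the wedge point: the orbits of [t] and of [s] are the boundary cycles of the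
   pieces over [A] and over [B], and the inequality compares Euler
   characteristics.  [e] lists the indices of the word in cyclic order; an index
   outside [e] is a fixed point with trivial labels, and adds one flat orbit on
   each side. *)
Definition diagram (I : finType) (e : seq I) (lab : I -> A * B) (s t : {perm I}) k : Prop :=
  [/\ uniq e,
      forall i, i \notin e -> t i = i /\ lab i = (1, 1),
      s * t = cycle_perm e &
      #|I|.*2 < size e + nflat t (fst \o lab) + nflat s (snd \o lab) + k.*2].

(* The [N] spare indices leave room for the insertion of letters. *)
Definition has_diagram W k : Prop := forall N,
  exists (I : finType) (e : seq I) (lab : I -> A * B) (s t : {perm I}),
    [/\ diagram e lab s t k, map lab e = W & size e + N <= #|I|].

Lemma diagram_outr (I : finType) (e : seq I) lab (s t : {perm I}) k i :
  diagram e lab s t k -> i \notin e -> s i = i.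
Proof.
case=> _ out stE _ ie; apply: (@perm_inj _ t).
by rewrite -permM stE cycle_perm_out //; case: (out i ie).
Qed.

Lemma has_diagramS W k : has_diagram W k -> has_diagram W k.+1.
Proof.
move=> + N => /(_ N)[I [e [lab [s [t [[Ue out stE chi] eW sI]]]]]].
by exists I, e, lab, s, t; split=> //; split=> //; lia.
Qed.

Lemma has_diagram_catC u v k : has_diagram (u ++ v) k -> has_diagram (v ++ u) k.
Proof.
move=> + N => /(_ N)[I [e [lab [s [t [[Ue out stE chi] eW sI]]]]]].
exists I, (rot (size u) e), lab, s, t; split; first split.
- by rewrite rot_uniq.
- by move=> i; rewrite mem_rot; apply: out.
- by rewrite stE -{1}(cat_take_drop (size u) e) -cycle_perm_catC ?cat_take_drop.
- by rewrite size_rot.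
- by rewrite map_rot eW rot_size_cat.
- by rewrite size_rot.
Qed.

Lemma has_diagram1 : has_diagram [:: (1, 1)] 0.
Proof.
move=> N; exists 'I_N.+1, [:: ord0], (fun=> (1, 1)), 1, 1; split; [split|..] => //.
- by move=> i _; rewrite perm1.
- by rewrite cycle_perm1 mulg1.
- by rewrite -[fst \o _]/(fun=> 1) -[snd \o _]/(fun=> 1) !nflat1 /=; lia.
- by rewrite card_ord.
Qed.

End Diagrams.

(* Reading the boundary word backwards and inverting it exchanges the factors. *)
Definition mirror (A B : groupType) (W : seq (A * B)) : seq (B * A) :=
  rev [seq (p.2^-1, p.1^-1) | p <- W].

Lemma mirror_cons (A B : groupType) (p : A * B) W :
  mirror (p :: W) = mirror W ++ [:: (p.2^-1, p.1^-1)].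
Proof. by rewrite /mirror map_cons rev_cons cats1. Qed.

Lemma mirrorK (A B : groupType) : cancel (@mirror A B) (@mirror B A).
Proof.
move=> W; rewrite /mirror map_rev revK -map_comp map_id_in // => -[a b] _.
by rewrite /= !invgK.
Qed.

Lemma has_diagram_mirror (A B : groupType) (W : seq (A * B)) k :
  has_diagram W k -> has_diagram (mirror W) k.
Proof.
move=> + N => /(_ N)[I [e [lab [s [t [D eW sI]]]]]]; have s_out := diagram_outr D.
case: D => Ue out stE chi; pose lab' i := ((lab i).2^-1, (lab i).1^-1).
exists I, (rev e), lab', t^-1, s^-1; split; first split.
- by rewrite rev_uniq.
- move=> i; rewrite mem_rev => ie; rewrite /lab'.
  by have [_ ->] := out i ie; rewrite /= !invg1 -{1}(s_out i ie) permK.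
- by rewrite -invgM stE cycle_perm_rev.
- rewrite size_rev /nflat.
  have -> := flat_porbitsV s (snd \o lab); have -> := flat_porbitsV t (fst \o lab).
  by move: chi; rewrite /nflat; lia.
- by rewrite /mirror -eW -map_comp map_rev.
- by rewrite size_rev.
Qed.

Lemma exists_notin (I : finType) (e : seq I) : uniq e -> size e < #|I| ->
  exists i, i \notin e.
Proof.
move=> Ue; rewrite -(card_uniqP Ue) => lt_e; apply/existsP; rewrite -negb_forall.
by apply: contraL lt_e => /forallP ee; rewrite -leqNgt subset_leq_card //; apply/subsetP.
Qed.

Section InsertDelete.
Variables A B : groupType.
Implicit Types (v : seq (A * B)) (k : nat).

Section Relabel.
Variables (I : finType) (lab : I -> A * B) (x y : I) (a1 a2 : A).

Definition relabel : I -> A * B :=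
  [eta lab with x |-> (a1, 1), y |-> (a2, (lab y).2)].

Lemma relabelD i : i != x -> i != y -> relabel i = lab i.
Proof. by rewrite /relabel /= => /negPf-> /negPf->. Qed.

Lemma map_relabel p : uniq [:: x, y & p] ->
  map relabel [:: x, y & p] = [:: (a1, 1), (a2, (lab y).2) & map lab p].
Proof.
rewrite /= inE negb_or -andbA => /and4P[nxy xp yp _].
rewrite {1 2}/relabel /= !eqxx eq_sym (negPf nxy); congr [:: _, _ & _].
by apply/eq_in_map => i ip; rewrite relabelD //; apply: contraTneq ip => ->.
Qed.

Lemma snd_relabel : (lab x).2 = 1 -> snd \o relabel = snd \o lab.
Proof.
move=> lx; apply/funext => i; rewrite /relabel /=.
by case: eqVneq => [->//|_]; case: eqVneq => [->|].
Qed.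

Lemma nflat_relabel (t : {perm I}) :
    t x = y -> x != y -> a1 * a2 = (lab x).1 * (lab y).1 ->
  nflat t (fst \o relabel) = nflat t (fst \o lab).
Proof.
move=> tx nxy aE; apply: (nflat_slide tx nxy) => [|i nix niy]; last by rewrite /= relabelD.
by rewrite /relabel /= !eqxx eq_sym (negPf nxy).
Qed.

End Relabel.

Lemma has_diagram_insertl (a1 a2 : A) (b : B) v k :
  has_diagram ((a1 * a2, b) :: v) k -> has_diagram [:: (a1, 1), (a2, b) & v] k.
Proof.
move=> + N => /(_ N.+1)[I [[|y p] [lab [s [t [[Ue out stE chi] //= [laby pv] sI]]]]]].
have [|x xe] := exists_notin Ue; first by move: sI => /=; lia.
have [tx labx] := out x xe; have /norP[nxy _] := xe.
have Uxe : uniq [:: x, y & p] by rewrite cons_uniq xe.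
exists I, [:: x, y & p], (relabel lab x y a1 a2), s, (t * tperm x y); split; first split.
- by [].
- move=> i; rewrite inE negb_or => /andP[nix ie]; have [ti labi] := out i ie.
  by have /norP[niy _] := ie; rewrite relabelD // permM ti tpermD // eq_sym.
- by rewrite mulgA stE.
- have txy : (t * tperm x y) x = y by rewrite permM tx tpermL.
  rewrite (nflat_relabel txy) ?labx ?laby ?mul1g // snd_relabel ?labx //.
  by have := nflatM_tperm t (fst \o lab) x y; move: chi => /=; lia.
- by rewrite map_relabel // laby pv.
- by move: sI => /=; lia.
Qed.

(* Cutting the index of the trivial letter out of its orbit gains the orbit that
   the compensating transposition on the other side may lose. *)
Lemma diagram_fix_trivial (I : finType) (e : seq I) (lab : I -> A * B) s t k x :
    diagram e lab s t k -> x \in e -> (lab x).2 = 1 ->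
  exists s' t' : {perm I}, diagram e lab s' t' k /\ s' x = x.
Proof.
move=> D xe lx; have [sx|sx] := eqVneq (s x) x; first by exists s, t.
have sxe : s x \in e.
  by apply: contraNT sx => /(diagram_outr D) /perm_inj ->.
case: D => Ue out stE chi; exists (s * tperm x (s x)), (tperm x (s x) * t).
split; last by rewrite permM tpermR.
split=> //.
- move=> i ie; have [ti labi] := out i ie; rewrite permM tpermD ?ti //.
    by apply: contraNneq ie => <-.
  by apply: contraNneq ie => <-.
- by rewrite -mulgA tpermKg stE.
- have := nflat_cut sx (lx : (snd \o lab) x = 1); have := nflat_tpermM t (fst \o lab) x (s x).
  by move: chi; lia.
Qed.

Lemma has_diagram_deletel (a1 a2 : A) (b : B) v k :
  has_diagram [:: (a1, 1), (a2, b) & v] k -> has_diagram ((a1 * a2, b) :: v) k.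
Proof.
move=> + N => /(_ N)[I [[|x [|y p]] [lab [s0 [t0 [D0 //= [labx laby pv] sI]]]]]].
have [|s [t [[Ue out stE chi] sx]]] := diagram_fix_trivial D0 (mem_head x _).
  by rewrite labx.
have := Ue; rewrite /= inE negb_or -andbA => /and4P[nxy _ yp Up].
have tx : t x = y by rewrite -{1}sx -permM stE cycle_perm_next //= eqxx.
pose lab' := relabel lab x y 1 (a1 * a2).
exists I, (y :: p), lab', s, (t * tperm x y); split; first split.
- by rewrite /= yp.
- move=> i; rewrite inE negb_or => /andP[niy ip]; rewrite permM.
  have [->|nix] := eqVneq i x; first by rewrite tx tpermR /lab' /relabel /= eqxx.
  have [|ti labi] := out i; first by rewrite !inE !negb_or nix niy.
  by rewrite /lab' relabelD // ti tpermD // eq_sym.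
- by rewrite mulgA stE -mulgA tperm2 mulg1.
- have fstE : nflat t (fst \o lab') = nflat t (fst \o lab).
    by rewrite (nflat_relabel tx) ?labx ?laby ?mul1g.
  have : nflat t (fst \o lab') < nflat (t * tperm x y) (fst \o lab').
    by rewrite -[in tperm x y]tx; apply: nflat_cut;
      rewrite ?tx 1?eq_sym // /lab' /relabel /= eqxx.
  by rewrite snd_relabel ?labx //; move: chi => /=; lia.
- by have := map_relabel lab 1 (a1 * a2) Ue; rewrite laby pv => /(congr1 behead).
- by move: sI => /=; lia.
Qed.

End InsertDelete.

Lemma has_diagram_insertr (A B : groupType) (a : A) (b1 b2 : B) v k :
  has_diagram ((a, b1 * b2) :: v) k -> has_diagram [:: (a, b1), (1, b2) & v] k.
Proof.
move=> /has_diagram_mirror; rewrite mirror_cons => /has_diagram_catC /=.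
rewrite invgM => /has_diagram_insertl /(has_diagram_catC (u := [:: _; _])) H.
rewrite -[[:: _, _ & v]]mirrorK; apply: has_diagram_mirror.
by rewrite !mirror_cons -catA /= invg1.
Qed.

Lemma has_diagram_deleter (A B : groupType) (a : A) (b1 b2 : B) v k :
  has_diagram [:: (a, b1), (1, b2) & v] k -> has_diagram ((a, b1 * b2) :: v) k.
Proof.
move=> /has_diagram_mirror; rewrite !mirror_cons -catA => /has_diagram_catC /=.
rewrite invg1 => /has_diagram_deletel; rewrite -invgM.
move=> /(has_diagram_catC (u := [:: _])) H.
by rewrite -[_ :: v]mirrorK; apply: has_diagram_mirror; rewrite mirror_cons.
Qed.

Lemma map_eq_rcons_cat (S T : Type) (f : S -> T) e u x v :
  map f e = rcons u x ++ v ->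
  exists p i q, [/\ e = rcons p i ++ q, map f (rcons p i) = rcons u x & map f q = v].
Proof.
move=> eE; pose n := size (rcons u x).
have takeE : map f (take n e) = rcons u x by rewrite map_take eE take_size_cat.
have dropE : map f (drop n e) = v by rewrite map_drop eE drop_size_cat.
case/lastP: (take n e) takeE (cat_take_drop n e) => [|p i] takeE eE'; first by case: (u) takeE.
by exists p, i, (drop n e).
Qed.

Lemma has_diagram_swap (A B : groupType) (u v w : seq (A * B)) k :
  has_diagram (u ++ v ++ w) k -> has_diagram (v ++ u ++ w) k.+1.
Proof.
case/lastP: u => [|u u0]; first exact: has_diagramS.
case/lastP: v => [|v v0]; first exact: has_diagramS.
case/lastP: w => [|w w0].
  by rewrite !cats0 => /has_diagram_catC; apply: has_diagramS.
move=> + N => /(_ N)[I [e [lab [s [t [[Ue out stE chi] eW sI]]]]]].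
have [p [i [e1 [eE pE e1E]]]] := map_eq_rcons_cat eW.
have [q [j [e2 [e1E' qE e2E]]]] := map_eq_rcons_cat e1E.
case/lastP: e2 e2E e1E' => [|r l] rE e1E'.
  by move/(congr1 size): rE; rewrite size_rcons.
subst e1 e.
exists I, (rcons q j ++ rcons p i ++ rcons r l), lab, (tperm i j * (tperm i l * s)), t.
split; first split.
- by rewrite uniq_catCA.
- by move=> x; rewrite (perm_mem (permEl (perm_catCA _ _ _))); apply: out.
- by rewrite cycle_perm_swap // -stE !mulgA.
- have := nflat_tpermM s (snd \o lab) i l; have := nflat_tpermM (tperm i l * s) (snd \o lab) i j.
  by move: chi; rewrite !size_cat; lia.
- by rewrite !map_cat pE qE rE.
- by move: sI; rewrite !size_cat; lia.
Qed.

(** * The free product of two groups *)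

Lemma unsorted_split (T : Type) (r : rel T) (s : seq T) : ~~ sorted r s ->
  exists u x y v, s = u ++ [:: x, y & v] /\ ~~ r x y.
Proof.
case: s => // x s; elim: s x => [|y s IH] x //=.
rewrite negb_and; have [_ /= /IH[u [z [w [v [-> nr]]]]]|nr _] := boolP (r x y).
  by exists (x :: u), z, w, v.
by exists [::], x, y, s.
Qed.

Section Words.
Variables A B : groupType.
Implicit Types (W X Y u v w x : seq (A * B)) (p q : A * B) (a : A) (b : B) (k : nat).

Fixpoint inv_word W : seq (A * B) :=
  if W is p :: W' then inv_word W' ++ [:: (1, p.2^-1); (p.1^-1, 1)] else [::].

Lemma has_diagram_insert_letter p u v k : 0 < size (u ++ v) -> has_diagram (u ++ v) k ->
  has_diagram (u ++ [:: (1, p.2^-1); (p.1^-1, 1); p] ++ v) k.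
Proof.
case: p => a b; rewrite size_cat addnC -size_cat => uv /has_diagram_catC H.
apply: has_diagram_catC => /=; case: (v ++ u) uv H => // -[c d] w _ H.
apply: (has_diagram_catC (u := [:: (a^-1, 1), (a, b), (c, d) & w]) (v := [:: (1, b^-1)])).
apply: has_diagram_insertl; rewrite mulVg.
apply: (has_diagram_catC (u := [:: (1, b^-1)]) (v := [:: (1, b), (c, d) & w])).
by apply: has_diagram_insertr; rewrite mulVg; apply: has_diagram_insertl; rewrite mul1g.
Qed.

Lemma has_diagram_insert_word X u v k : 0 < size (u ++ v) ->
  has_diagram (u ++ v) k -> has_diagram (u ++ inv_word X ++ X ++ v) k.
Proof.
elim: X u v => [|p X IH] u v uv H //=.
have := @has_diagram_insert_letter p (u ++ inv_word X) (X ++ v) k.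
rewrite -!catA /=; apply; last exact: IH.
by move: uv; rewrite !size_cat; lia.
Qed.

Lemma has_diagram_comm X Y v k : 0 < size v -> has_diagram v k ->
  has_diagram (inv_word X ++ inv_word Y ++ X ++ Y ++ v) k.+1.
Proof.
move=> v0 /(has_diagram_insert_word (u := [::]) Y v0) HY.
have /= HX := has_diagram_insert_word (u := [::]) X _ HY.
apply: has_diagram_catC; rewrite -!catA; apply: has_diagram_swap.
rewrite 3!catA; apply: has_diagram_catC; rewrite -!catA; apply: HX.
by move: v0; rewrite /= !size_cat; lia.
Qed.

Definition no_cancel p q := (p.2 != 1) && (q.1 != 1).

(* Only the first [A]-letter and the last [B]-letter of a reduced word may be
   trivial: every element of the free product has exactly one such form. *)
Definition reduced x := (x != [::]) && sorted no_cancel x.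

(* A reduced word is a [B]-letter followed by a tail, in a unique way. *)
Definition is_tail w := (if w is q :: _ then q.1 != 1 else true) && sorted no_cancel w.

Definition split_tail x : B * seq (A * B) :=
  if x is (a, b) :: w then if a == 1 then (b, w) else (1, x) else (1, x).

Definition glue_tail b w : seq (A * B) :=
  if (b == 1) && (w != [::]) then w else (1, b) :: w.

Lemma is_tail_split x : reduced x -> is_tail (split_tail x).2.
Proof.
rewrite /reduced; case: x => [|[a b] w] //= xr.
have [a1|na1] /= := eqVneq a 1; last by rewrite /is_tail /= na1.
by case: w xr => //= q w /= /andP[/andP[_ qn] qw]; rewrite /is_tail qn.
Qed.

Lemma split_tailK x : reduced x -> glue_tail (split_tail x).1 (split_tail x).2 = x.
Proof.
case: x => [|[a b] w] //= xr; have [->|na1] /= := eqVneq a 1; last first.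
  by rewrite /glue_tail eqxx.
rewrite /glue_tail; case: w xr => [|q w] /=; first by rewrite andbF.
by rewrite /reduced /= => /andP[/andP[/negPf-> _] _].
Qed.

Lemma glue_tailK b w : is_tail w -> split_tail (glue_tail b w) = (b, w).
Proof.
rewrite /is_tail /glue_tail; case: w => [|[a c] w] /=; first by rewrite andbF /= eqxx.
by move=> /andP[/negPf na1 _]; have [->|nb] := eqVneq b 1; rewrite /= ?na1 // eqxx.
Qed.

Lemma reduced_glue b w : is_tail w -> reduced (glue_tail b w).
Proof.
rewrite /is_tail /glue_tail; case: w => [|[a c] w] /=; first by rewrite andbF.
by move=> /andP[na1 wr]; have [_|nb] := eqVneq b 1; rewrite /reduced //= /no_cancel /= nb na1.
Qed.

(* Words that are not reduced are fixed, so that both factors act on all words. *)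
Definition actl a x : seq (A * B) :=
  if x is (a', b) :: w then if reduced x then (a * a', b) :: w else x else x.

Definition actr b x : seq (A * B) :=
  if reduced x then glue_tail (b * (split_tail x).1) (split_tail x).2 else x.

Lemma reduced_head a a' b w : reduced ((a, b) :: w) = reduced ((a', b) :: w).
Proof. by case: w. Qed.

Lemma actl1 x : actl 1 x = x.
Proof. by case: x => [|[a b] w] //=; rewrite mul1g if_same. Qed.

Lemma actlM a a' x : actl a (actl a' x) = actl (a * a') x.
Proof.
case: x => [|[c b] w] //=; case: ifP => /= cr; last by rewrite cr.
by rewrite (reduced_head _ c) cr mulgA.
Qed.

Lemma actr1 x : actr 1 x = x.
Proof. by rewrite /actr; case: ifP => // xr; rewrite mul1g split_tailK. Qed.

Lemma actrM b b' x : actr b (actr b' x) = actr (b * b') x.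
Proof.
rewrite /actr; have [xr|xr] := boolP (reduced x); last by rewrite (negPf xr).
by have xt := is_tail_split xr; rewrite reduced_glue // glue_tailK //= mulgA.
Qed.

Definition act_word W x := foldr (fun p y => actl p.1 (actr p.2 y)) x W.

Lemma act_word_cat u v x : act_word (u ++ v) x = act_word u (act_word v x).
Proof. exact: foldr_cat. Qed.

Lemma act_word_deletel a1 a2 b v x :
  act_word [:: (a1, 1), (a2, b) & v] x = act_word ((a1 * a2, b) :: v) x.
Proof. by rewrite /= actr1 actlM. Qed.

Lemma act_word_deleter a b1 b2 v x :
  act_word [:: (a, b1), (1, b2) & v] x = act_word ((a, b1 * b2) :: v) x.
Proof. by rewrite /= actl1 actrM. Qed.

Lemma act_wordK W : cancel (act_word W) (act_word (inv_word W)).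
Proof.
elim: W => [|[a b] W IH] x //=; rewrite act_word_cat /=.
by rewrite actr1 actlM mulVg !actl1 actrM mulVg actr1 IH.
Qed.

Lemma act_wordKV W : cancel (act_word (inv_word W)) (act_word W).
Proof.
elim: W => [|[a b] W IH] x //=; rewrite act_word_cat /= IH.
by rewrite actl1 actrM mulgV actr1 actr1 actlM mulgV actl1.
Qed.

Lemma act_word_reduced W : reduced W -> act_word W [:: (1, 1)] = W.
Proof.
elim: W => // -[a b] [|[a2 b2] W] IH Wr.
  by rewrite /= /actr /= eqxx /glue_tail andbF mulg1 /= mulg1.
have W'r : reduced ((a2, b2) :: W) by move: Wr; rewrite /reduced /= => /andP[].
have /andP[nb na2] : (b != 1) && (a2 != 1) by move: Wr; rewrite /reduced /= => /andP[].
rewrite -[LHS]/(actl a (actr b (act_word ((a2, b2) :: W) _))) IH //.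
rewrite /actr W'r /= (negPf na2) mulg1 /glue_tail (negPf nb) /=.
by rewrite (reduced_head _ a) Wr mulg1.
Qed.

Lemma has_diagram_shorten W k : 0 < size W -> ~~ reduced W -> has_diagram W k ->
  exists W', [/\ 0 < size W' < size W, has_diagram W' k & act_word W' =1 act_word W].
Proof.
move=> W0; have -> : reduced W = sorted no_cancel W by case: (W) W0.
case/unsorted_split=> u [[a1 b1] [[a2 b2] [v [-> nc]]]] /has_diagram_catC.
have shorten p : 0 < size (u ++ p :: v) < size (u ++ [:: (a1, b1), (a2, b2) & v]).
  by rewrite !size_cat /=; lia.
move: nc shorten; rewrite negb_and !negbK /= => /orP[/eqP-> | /eqP->] shorten.
- move=> /has_diagram_deletel /(has_diagram_catC (u := _ :: _)) H.
  exists (u ++ (a1 * a2, b2) :: v); split=> // x.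
  by rewrite !act_word_cat act_word_deletel.
- move=> /has_diagram_deleter /(has_diagram_catC (u := _ :: _)) H.
  exists (u ++ (a1, b1 * b2) :: v); split=> // x.
  by rewrite !act_word_cat act_word_deleter.
Qed.

Lemma has_diagram_reduce W k : 0 < size W -> has_diagram W k ->
  exists W', [/\ reduced W', has_diagram W' k & act_word W' =1 act_word W].
Proof.
have [n] := ubnP (size W); elim: n W => // n IH W sW W0 HW.
have [rW|nrW] := boolP (reduced W); first by exists W.
have [V [/andP[V0 sV] HV VW]] := has_diagram_shorten W0 nrW HW.
have [|V' [rV' HV' V'V]] := IH V _ V0 HV; first exact: leq_trans sV _.
by exists V'; split=> // x; rewrite V'V.
Qed.

End Words.

Lemma morphM_monoid_morphism (G H : groupType) (f : G -> H) :
  {morph f : x y / x * y} -> monoid_morphism f.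
Proof. by move=> fM; split=> //; apply: (@mulgI _ (f 1)); rewrite -fM !mulg1. Qed.

Section FreeProduct.
Variables A B : groupType.
Implicit Types (W u v : seq (A * B)).

(* Van der Waerden's construction: the permutations of words induced by words. *)
Definition freeprod : Type := {f : seq (A * B) -> seq (A * B) | exists W, f = act_word W}.
HB.instance Definition _ := Choice.copy freeprod {classic freeprod}.
Implicit Types f g h : freeprod.

Definition of_word W : freeprod := exist _ (act_word W) (ex_intro _ W erefl).

Definition word f : seq (A * B) := projT1 (cid (svalP f)).

Lemma act_word_word f : act_word (word f) = sval f.
Proof. by rewrite /word; case: cid. Qed.

Lemma freeprod_inj f g : sval f = sval g -> f = g.
Proof.
case: f g => [f Wf] [g Wg] /= fg; case: g / fg Wg => Wg.
by congr exist; apply: Prop_irrelevance.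
Qed.

Lemma wordK : cancel word of_word.
Proof. by move=> f; apply: freeprod_inj; rewrite /= act_word_word. Qed.

Definition freeprod_mul f g := of_word (word f ++ word g).
Definition freeprod_inv f := of_word (inv_word (word f)).

Lemma sval_freeprod_mul f g : sval (freeprod_mul f g) = sval f \o sval g.
Proof. by apply/funext => x; rewrite /= act_word_cat !act_word_word. Qed.

Lemma freeprod_mulA : associative freeprod_mul.
Proof. by move=> f g h; apply: freeprod_inj; rewrite !sval_freeprod_mul. Qed.

Lemma freeprod_mul1l : left_id (of_word [::]) freeprod_mul.
Proof. by move=> f; apply: freeprod_inj; rewrite sval_freeprod_mul. Qed.

Lemma freeprod_mul1r : right_id (of_word [::]) freeprod_mul.
Proof. by move=> f; apply: freeprod_inj; rewrite sval_freeprod_mul. Qed.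

Lemma freeprod_mulVl : left_inverse (of_word [::]) freeprod_inv freeprod_mul.
Proof.
move=> f; apply: freeprod_inj; rewrite sval_freeprod_mul -(act_word_word f).
by apply/funext => x; rewrite /= act_wordK.
Qed.

Lemma freeprod_mulVr : right_inverse (of_word [::]) freeprod_inv freeprod_mul.
Proof.
move=> f; apply: freeprod_inj; rewrite sval_freeprod_mul -(act_word_word f).
by apply/funext => x; rewrite /= act_wordKV.
Qed.

HB.instance Definition _ := isGroup.Build freeprod
  freeprod_mulA freeprod_mul1l freeprod_mul1r freeprod_mulVl freeprod_mulVr.

Lemma of_word_cat u v : of_word (u ++ v) = of_word u * of_word v.
Proof.
apply: freeprod_inj; rewrite [RHS]sval_freeprod_mul.
by apply/funext => x; rewrite /= act_word_cat.
Qed.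

Lemma eq_of_word u v : act_word u =1 act_word v -> of_word u = of_word v.
Proof. by move=> uv; apply/freeprod_inj/funext. Qed.

Lemma of_word_inv W : of_word (inv_word W) = (of_word W)^-1.
Proof.
apply/esym/mulg1_eq; rewrite -of_word_cat; apply: eq_of_word => x.
by rewrite act_word_cat act_wordKV.
Qed.

Definition freeprod_inl (a : A) : freeprod := of_word [:: (a, 1)].
Definition freeprod_inr (b : B) : freeprod := of_word [:: (1, b)].

Lemma freeprod_inlM : {morph freeprod_inl : a a' / a * a'}.
Proof.
by move=> a a'; rewrite -of_word_cat; apply: eq_of_word => x; rewrite act_word_deletel.
Qed.

Lemma freeprod_inrM : {morph freeprod_inr : b b' / b * b'}.
Proof.
by move=> b b'; rewrite -of_word_cat; apply: eq_of_word => x; rewrite act_word_deleter.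
Qed.

HB.instance Definition _ :=
  isUMagmaMorphism.Build A freeprod freeprod_inl (morphM_monoid_morphism freeprod_inlM).
HB.instance Definition _ :=
  isUMagmaMorphism.Build B freeprod freeprod_inr (morphM_monoid_morphism freeprod_inrM).

Lemma comm_prod_has_diagram k (f : freeprod) : comm_prod k f ->
  exists W, [/\ 0 < size W, has_diagram W k & of_word W = f].
Proof.
case=> l <- <-; elim: l => [|[f1 f2] l [W [W0 HW WE]]].
  exists [:: (1, 1)]; split=> //; first exact: has_diagram1.
  by rewrite big_nil; apply: eq_of_word => x; rewrite /= actl1 actr1.
exists (inv_word (word f1) ++ inv_word (word f2) ++ word f1 ++ word f2 ++ W); split.
- by rewrite !size_cat; lia.
- exact: has_diagram_comm.
- by rewrite !of_word_cat !of_word_inv !wordK WE big_cons /commg /conjg !mulgA.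
Qed.

Lemma reduced_comm_prod_has_diagram k W : reduced W -> comm_prod k (of_word W) ->
  has_diagram W k.
Proof.
move=> rW /comm_prod_has_diagram[V [V0 HV VE]].
have [V' [rV' HV' V'E]] := has_diagram_reduce V0 HV.
suff <- : V' = W by [].
rewrite -(act_word_reduced rV') V'E -(act_word_reduced rW).
by rewrite -[act_word V]/(sval (of_word V)) VE.
Qed.

End FreeProduct.

(** * Counting flat orbits *)

Section ElementOrder.
Variable G : groupType.
Implicit Types (x : G) (d k : nat).

(* An element of infinite order has order [0], as [0 %| k] only if [k = 0]. *)
Definition is_order x d : Prop := forall k, (x ^+ k == 1) = (d %| k).

Lemma is_order_eq1 x d : is_order x d -> (d == 1%N) = (x == 1).
Proof. by move=> xd; rewrite -[x]expg1 xd dvdn1. Qed.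

Lemma is_orderV x d : is_order x d -> is_order x^-1 d.
Proof. by move=> xd k; rewrite expVgn invg_eq1. Qed.

End ElementOrder.

Lemma leq_div_half n d : d != 1%N -> n %/ d <= n./2.
Proof. by case: d => [|[//|d]] _; rewrite ?divn0 // -divn2 leq_div2l. Qed.

Definition leq_order d d' := (d' == 0) || (0 < d <= d').

Lemma leq_order_divD d d' m n : leq_order d d' -> m %/ d + n %/ d' <= (m + n) %/ d.
Proof.
case/orP=> [/eqP-> | /andP[d0 dd']].
  by rewrite divn0 addn0; apply/leq_div2r/leq_addr.
rewrite (divnD _ _ d0) -addnA leq_add2l.
by apply: leq_trans (leq_div2l n d0 dd') (leq_addr _ _).
Qed.

Section OrbitCount.
Variables (G : groupType) (I : finType) (s : {perm I}) (lab : I -> G).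
Implicit Types (C D E P : {set I}) (x i : I) (d : nat) (y : G).

Lemma flat_porbit_const x y : porbit s x \in flat_porbits s lab ->
  {in porbit s x, forall i, lab i = y} -> y ^+ #|porbit s x| = 1.
Proof.
move=> /flat_porbitsP[_ [h hP]] laby.
have hX k : h (iter k s x) = h x * y ^+ k.
  elim: k => [|k IH]; first by rewrite mulg1.
  have kx : iter k s x \in porbit s x by rewrite -permX mem_porbit.
  by rewrite iterS hP // laby // IH expgSr mulgA.
by apply: (@mulgI _ (h x)); rewrite -hX iter_porbit mulg1.
Qed.

Lemma card_flat_porbits_const D y d : {in D, forall i, lab i = y} -> is_order y d ->
  #|[set C in flat_porbits s lab | C \subset D]| <= #|D| %/ d.
Proof.
move=> laby yd; set F := [set C in _ | _].
have FP C : C \in F -> [/\ C \subset D, 0 < #|C| & d %| #|C|].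
  move=> /setIdP[CF CD]; split=> //; have /flat_porbitsP[/imsetP[x _ CE] _] := CF.
    by rewrite CE lt0n card_porbit_neq0.
  by rewrite -yd CE (@flat_porbit_const x y) -?CE // => i /(subsetP CD)/laby.
have coverF : \sum_(C in F) #|C| <= #|D|.
  have /eqP-> : trivIset F.
    by apply: trivIsetS (trivIset_flat_porbits s lab); apply/subsetP => C /setIdP[].
  by apply/subset_leq_card/bigcupsP => C /FP[].
have [d0|d0] := posnP d; last first.
  rewrite leq_divRL // -sum_nat_const; apply: leq_trans coverF.
  by apply: leq_sum => C /FP[_ C0]; apply: dvdn_leq.
suff -> : F = set0 by rewrite cards0.
apply/setP => C; rewrite in_set0; apply/negP => /FP[_ C0].
by rewrite d0 dvd0n; apply/negP; rewrite -lt0n.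
Qed.

Variables (E P : {set I}).
Hypothesis PE : P \subset E.

Let Q := E :\: P.

Lemma porbits_cases C : C \in porbits s ->
  [\/ exists2 i, i \in ~: E :|: Q :&: s @^-1: P & C = porbit s i,
      C \subset P :&: s @^-1: P | C \subset Q :&: s @^-1: Q].
Proof.
move=> Cs; have [/exists_inP[i iC iEQ]|] := boolP [exists i in C, i \in ~: E :|: Q :&: s @^-1: P].
  by apply: Or31; exists i; rewrite // (porbits_mem Cs iC).
move/exists_inPn => noEQ.
have CE i : i \in C -> i \in E by move/noEQ; rewrite !inE negb_or negbK => /andP[].
have stayQ i : i \in C -> i \in Q -> s i \in Q.
  move=> iC iQ; rewrite inE CE ?(porbits_closed _ Cs) // andbT.
  by move: (noEQ i iC); rewrite in_setU => /norP[_]; rewrite in_setI iQ inE.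
have stay D : C \subset D -> C \subset D :&: s @^-1: D.
  move=> /subsetP CD; apply/subsetP => i iC.
  by rewrite !inE !CD ?(porbits_closed _ Cs).
have [/exists_inP[i iC iQ]|/exists_inPn noQ] := boolP [exists i in C, i \in Q].
- apply/Or33/stay/subsetP => j; rewrite (porbits_mem Cs iC) => ji.
  suff [] : j \in C /\ j \in Q by [].
  by move: j ji; apply: porbit_ind => // j [jC jQ]; rewrite (porbits_closed _ Cs) stayQ.
- apply/Or32/stay/subsetP => i iC; move: (noQ i iC).
  by rewrite inE CE // andbT negbK.
Qed.

Lemma nflat_leq y d : is_order y d ->
    {in P, forall i, lab i = y} -> {in Q, forall i, lab i = y^-1} ->
  nflat s lab <= #|~: E| + #|Q :&: s @^-1: P| +
    (#|P :&: s @^-1: P| %/ d + #|Q :&: s @^-1: Q| %/ d).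
Proof.
move=> yd labP labQ; pose F D := [set C in flat_porbits s lab | C \subset D].
have cover : flat_porbits s lab \subset
    porbit s @: (~: E :|: Q :&: s @^-1: P) :|: (F (P :&: s @^-1: P) :|: F (Q :&: s @^-1: Q)).
  apply/subsetP => C CF; have /flat_porbitsP[Cs _] := CF.
  rewrite in_setU in_setU !(in_set (fun C => (C \in flat_porbits s lab) && _)) CF /=.
  have [[i iEQ ->]|->|->] := porbits_cases Cs; rewrite ?orbT //.
  by rewrite imset_f.
apply: leq_trans (subset_leq_card cover) _.
apply: leq_trans (leq_card_setU _ _).1 (leq_add _ _).
  by apply: leq_trans (leq_imset_card _ _) (leq_card_setU _ _).1.
apply: leq_trans (leq_card_setU _ _).1 (leq_add _ _).
  by apply: card_flat_porbits_const (yd) => i /setIP[/labP].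
by apply: card_flat_porbits_const (is_orderV yd) => i /setIP[/labQ].
Qed.

Hypothesis sE : perm_on E s.

Lemma card_turns_into : #|P :&: s @^-1: P| + #|Q :&: s @^-1: P| = #|P|.
Proof.
rewrite -[RHS](card_preimset P (@perm_inj _ s)) -[RHS](cardsID P) setIC.
congr (_ + #|pred_of_set _|); apply/setP => i; rewrite !inE.
by case siP: (s i \in P); rewrite ?andbF // -(perm_closed i sE) (subsetP PE _ siP) !andbT.
Qed.

Lemma card_turns_from : #|Q :&: s @^-1: P| + #|Q :&: s @^-1: Q| = #|Q|.
Proof.
rewrite -[RHS](cardsID (s @^-1: P)); congr (_ + #|pred_of_set _|).
apply/setP => i; rewrite !inE (perm_closed i sE).
by case: (i \in E); rewrite ?andbF ?andbT // andbC.
Qed.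

Lemma nflat_leq_balanced y d : is_order y d -> #|P| = #|Q| ->
    {in P, forall i, lab i = y} -> {in Q, forall i, lab i = y^-1} ->
  nflat s lab + #|P :&: s @^-1: P| <= #|~: E| + #|P| + (#|P :&: s @^-1: P| %/ d).*2.
Proof.
move=> yd PQ labP labQ; have := nflat_leq yd labP labQ.
have := card_turns_into; have := card_turns_from.
have -> : #|Q :&: s @^-1: Q| = #|P :&: s @^-1: P| by move: card_turns_into card_turns_from; lia.
by lia.
Qed.

End OrbitCount.

Lemma odd_index_next (T : eqType) (e : seq T) i : uniq e -> ~~ odd (size e) -> i \in e ->
  odd (index (next e i) e) = ~~ odd (index i e).
Proof.
move=> Ue even_e ie; rewrite next_nth ie; case: e ie Ue even_e => // x p.
rewrite -index_mem ltnS leq_eqVlt => /orP[/eqP ip|lt_i] Ue even_e.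
  by rewrite nth_default ip // index_head -[~~ _]/(odd (size (x :: p))) (negPf even_e).
by rewrite -[nth x p _]/(nth x (x :: p) (index i (x :: p)).+1) index_uniq.
Qed.

Section CommWord.
Variables (A B : groupType) (a : A) (t : B).
Implicit Types (n k : nat).

Definition comm_word n : seq (A * B) :=
  mkseq (fun i => if odd i then (a, t) else (a^-1, t^-1)) n.*2.

Lemma comm_word_reduced n : a != 1 -> t != 1 -> 0 < n -> reduced (comm_word n).
Proof.
move=> na nt n0; rewrite /reduced -size_eq0 size_mkseq double_eq0 -lt0n n0.
apply/(sortedP (1, 1)) => i; rewrite size_mkseq => lti.
rewrite !nth_mkseq // 1?ltnW //= /no_cancel.
by case: odd; rewrite /= ?invg_eq1 na nt.
Qed.

Lemma of_word_pair (x : A) (y : B) :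
  of_word [:: (x, y)] = freeprod_inl B x * freeprod_inr A y.
Proof.
rewrite -of_word_cat; apply: eq_of_word => z.
by rewrite [_ ++ _]/= act_word_deleter mul1g.
Qed.

Lemma of_comm_word n :
  of_word (comm_word n) = [~ freeprod_inl B a, freeprod_inr A t] ^+ n.
Proof.
elim: n => [|n IH]; first exact: freeprod_inj.
rewrite /comm_word doubleS !mkseqS -!cats1 !of_word_cat -/(comm_word n) IH expgSr /=.
by rewrite odd_double /= !of_word_pair !gmulfV /= /commg /conjg !mulgA.
Qed.

Section DiagramBound.
Variables (n k : nat) (I : finType) (e : seq I) (lab : I -> A * B) (s r : {perm I}).
Hypotheses (D : diagram e lab s r k) (eW : map lab e = comm_word n).

Let E := [set i in e].
Let P := [set i in e | odd (index i e)].
Let Q := E :\: P.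

Lemma comm_diagram_uniq : uniq e.
Proof. by case: D. Qed.

Lemma comm_diagram_size : size e = n.*2.
Proof. by rewrite -(size_map lab) eW size_mkseq. Qed.

Lemma comm_diagram_label : {in e, forall i, lab i = if i \in P then (a, t) else (a^-1, t^-1)}.
Proof.
move=> i ie; have lti : index i e < n.*2 by rewrite -comm_diagram_size index_mem.
rewrite inE ie -(nth_mkseq (a, t) (fun i => if odd i then _ else _) lti) -/(comm_word n).
by rewrite -eW (nth_map i) ?index_mem // nth_index.
Qed.

Lemma comm_diagram_alternate i : (r (s i) \in P) = (i \in Q).
Proof.
have [Ue _ srE _] := D; rewrite -permM srE cycle_perm_next // !inE mem_next.
case: (boolP (i \in e)) => //= ie; rewrite odd_index_next ?andbT //.
by rewrite comm_diagram_size odd_double.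
Qed.

Lemma comm_diagram_sub : P \subset E.
Proof. by apply/subsetP => i; rewrite !inE => /andP[]. Qed.

Lemma comm_diagram_cardE : #|E| = n.*2.
Proof. by rewrite -comm_diagram_size /E cardsE; apply/card_uniqP/comm_diagram_uniq. Qed.

Lemma comm_diagram_card : #|P| = n /\ #|Q| = n.
Proof.
have PQ : #|P| = #|Q|.
  rewrite -(card_preimset P (@perm_inj _ (s * r))); congr #|pred_of_set _|.
  by apply/setP => i; rewrite inE permM comm_diagram_alternate.
have := cardsID P E; rewrite (setIidPr comm_diagram_sub) -/Q -PQ addnn comm_diagram_cardE.
by move/double_inj.
Qed.

Lemma comm_diagram_onl : perm_on E r.
Proof.
have [_ out _ _] := D; apply/subsetP => i; apply: contraNT.
by rewrite inE => /out[->].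
Qed.

Lemma comm_diagram_onr : perm_on E s.
Proof. by apply/subsetP => i; apply: contraNT; rewrite inE => /(diagram_outr D)->. Qed.

Lemma comm_diagram_turns : #|P :&: s @^-1: P| + #|P :&: r @^-1: P| = n.
Proof.
have PE := comm_diagram_sub; have [<- _] := comm_diagram_card.
rewrite -(card_turns_into PE comm_diagram_onr); congr (_ + _).
rewrite -(card_preimset (P :&: r @^-1: P) (@perm_inj _ s)); congr #|pred_of_set _|.
apply/setP => i; rewrite in_setI -comm_diagram_alternate [i \in s @^-1: P]inE.
by rewrite [LHS]inE in_setI [_ \in r @^-1: P]inE andbC.
Qed.

Lemma comm_diagram_bound d d' : is_order a d -> is_order t d' -> leq_order d d' ->
  n < k.*2 + (n %/ d).*2.
Proof.
move=> ad td' dd'; have PE := comm_diagram_sub.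
have [cP cQ] := comm_diagram_card; have cPQ : #|P| = #|Q| by rewrite cP cQ.
have labP i : i \in P -> lab i = (a, t).
  by move=> iP; rewrite comm_diagram_label ?iP // -[_ \in e]in_set (subsetP PE).
have labQ i : i \in Q -> lab i = (a^-1, t^-1).
  by move/setDP=> [iE /negPf iP]; rewrite comm_diagram_label ?iP // -[_ \in e]in_set.
have boundA := nflat_leq_balanced (lab := fst \o lab) PE comm_diagram_onl ad cPQ
  (fun i iP => congr1 fst (labP i iP)) (fun i iQ => congr1 fst (labQ i iQ)).
have boundB := nflat_leq_balanced (lab := snd \o lab) PE comm_diagram_onr td' cPQ
  (fun i iP => congr1 snd (labP i iP)) (fun i iQ => congr1 snd (labQ i iQ)).
have [_ _ _ chi] := D; have turns := comm_diagram_turns.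
have := leq_order_divD #|P :&: r @^-1: P| #|P :&: s @^-1: P| dd'.
rewrite (addnC #|P :&: r @^-1: P|) turns.
have := cardsC E; rewrite comm_diagram_cardE.
by move: chi boundA boundB; rewrite comm_diagram_size cP; lia.
Qed.

End DiagramBound.

Theorem comm_prod_freeprod_commX_gt n k d d' :
    a != 1 -> t != 1 -> is_order a d -> is_order t d' -> leq_order d d' -> 0 < n ->
    comm_prod k ([~ freeprod_inl B a, freeprod_inr A t] ^+ n) ->
  n./2 - n %/ d < k.
Proof.
move=> na nt ad td' dd' n0; rewrite -of_comm_word.
move=> /(reduced_comm_prod_has_diagram (comm_word_reduced na nt n0)).
move=> /(_ 0)[I [e [lab [s [r [D eW _]]]]]].
have := comm_diagram_bound D eW ad td' dd'.
by have := @leq_div_half n d; rewrite (is_order_eq1 ad) => /(_ na); lia.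
Qed.

End CommWord.

(** * Abstract free products *)

HB.instance Definition _ (G : group) := Choice.copy (carrier G) {classic G}.
HB.instance Definition _ (G : group) := @isGroup.Build (carrier G) gone ginv gmul
  (@gmulA G) (@gmul1l G) (@gmul1r G) (@gmulVl G) (@gmulVr G).
HB.instance Definition _ (G H : group) (f : hom G H) :=
  isUMagmaMorphism.Build (carrier G) (carrier H) (hmap f) (morphM_monoid_morphism (hmapM G H f)).

Definition group_of (G : groupType) : group :=
  @Defs.Group G mul 1 inv (@mulgA G) (@mul1g G) (@mulg1 G) (@mulVg G) (@mulgV G).

Lemma comm_prod_morph (G H : groupType) (f : UMagmaMorphism.type G H) k x :
  comm_prod k x -> comm_prod k (f x).
Proof.
case=> s <- <-; exists [seq (f p.1, f p.2) | p <- s]; first exact: size_map.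
by rewrite gmulf_prod big_map; apply: eq_bigr => p _; rewrite gmulfR.
Qed.

Section GroupRecord.
Variable G : group.
Implicit Types (x h : G) (k n : nat) (o : option nat).

Lemma gpowE x n : gpow x n = x ^+ n.
Proof. by elim: n => [|n /= ->] //; rewrite expgS. Qed.

Lemma prod_commE (l : list (G * G)) : prod_comm l = \prod_(p <- l) [~ p.1, p.2].
Proof. by elim: l => [|[x y] l /= ->]; rewrite ?big_nil ?big_cons. Qed.

Lemma comm_prod_comm_length h k : comm_prod k h -> (forall l, comm_prod l h -> k <= l) ->
  comm_length h k.
Proof.
move=> [l lk lh] kmin; split; first by exists l; rewrite prod_commE.
by move=> l'; rewrite prod_commE => l'h; apply/leP/kmin; exists l'.
Qed.

Lemma has_order_is_order x o : has_order x o -> is_order x (odflt 0 o).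
Proof.
case: o => [d [/ltP d0 [xd dmin]]|inf] k /=; last first.
  rewrite dvd0n; case: k => [|k]; first by rewrite expg0 !eqxx.
  by have /eqP/negPf-> : x ^+ k.+1 <> 1 by rewrite -gpowE; apply: inf; apply/ltP.
rewrite gpowE in xd; rewrite [in LHS](divn_eq k d) expgnDr mulnC expgnA xd expg1n mul1g.
apply/eqP/idP => [xr|/eqP->//]; apply: contraT; rewrite /dvdn -lt0n => r0.
case: (dmin (k %% d)); rewrite ?gpowE //; split; apply/ltP => //; exact: ltn_pmod.
Qed.

End GroupRecord.

Lemma Nat_divE n d : Nat.div n d = n %/ d.
Proof.
case: d => [|d]; first by rewrite divn0.
apply/esym/(PeanoNat.Nat.div_unique _ _ _ (n %% d.+1)); first exact/ltP/ltn_pmod.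
by rewrite {1}(divn_eq n d.+1) mulnC.
Qed.

Lemma div_ordE n o : div_ord n o = n %/ odflt 0 o.
Proof. by case: o => [d|] /=; rewrite ?Nat_divE ?divn0. Qed.

Lemma ord_le_leq_order (G H : group) (x : G) (y : H) o o' :
  has_order x o -> has_order y o' -> ord_le o o' -> leq_order (odflt 0 o) (odflt 0 o').
Proof.
rewrite /leq_order; case: o o' => [d|] [d'|] //= [/ltP d0 _] _ /leP dd'.
by rewrite d0 dd' orbT.
Qed.

Section Projection.
Variables (J : Type) (A : J -> Defs.group) (G : group) (inj : forall j, hom (A j) G).
Hypothesis freeG : is_free_product J A G inj.
Variables (j1 j2 : J).
Hypothesis nj : j1 <> j2.

Let P := freeprod (A j1) (A j2).

Definition hom_inl : hom (A j1) (group_of P) := @Defs.Hom _ (group_of P) _ (@freeprod_inlM _ _).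
Definition hom_inr : hom (A j2) (group_of P) := @Defs.Hom _ (group_of P) _ (@freeprod_inrM _ _).
Definition hom_triv (H : group) : hom H (group_of P) :=
  @Defs.Hom H (group_of P) (fun=> 1) (fun _ _ => esym (mul1g 1)).

Lemma free_product_proj : exists phi : hom G (group_of P),
  (forall x, phi (inj j1 x) = freeprod_inl _ x) /\
  (forall y, phi (inj j2 y) = freeprod_inr _ y).
Proof.
pose f j : hom (A j) (group_of P) :=
  match pselect (j1 = j), pselect (j2 = j) with
  | left e, _ => ecast j (hom (A j) (group_of P)) e hom_inl
  | _, left e => ecast j (hom (A j) (group_of P)) e hom_inr
  | _, _ => hom_triv (A j)
  end.
have [phi [phiE _]] := freeG f; exists phi; split=> x; rewrite phiE /f.
  by case: pselect => // e; rewrite (Prop_irrelevance e erefl).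
by do 2![case: pselect => //] => e; rewrite (Prop_irrelevance e erefl).
Qed.

Lemma comm_prod_free_product_commX_gt (a : A j1) (t : A j2) (oa ot : option nat) n k :
    a <> gone -> t <> gone -> has_order a oa -> has_order t ot -> ord_le oa ot -> 0 < n ->
    comm_prod k ([~ inj j1 a, inj j2 t] ^+ n) ->
  n./2 - n %/ odflt 0 oa < k.
Proof.
move=> /eqP na /eqP nt aoa tot le_ord n0; have [phi [phi_inl phi_inr]] := free_product_proj.
move=> /(comm_prod_morph phi); rewrite gmulfXn gmulfR /= phi_inl phi_inr.
exact: (comm_prod_freeprod_commX_gt na nt (has_order_is_order aoa) (has_order_is_order tot)
  (ord_le_leq_order aoa tot le_ord) n0).
Qed.

End Projection.

(* Restores the notations of [nat] that those of [ssrnat] shadow. *)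
Import Corelib.Init.Peano PeanoNat.
Local Close Scope group_scope.

Theorem theorem3 (J : Type) (A : J -> group) (G : group)
    (inj : forall j, hom (A j) G)
    (HG : is_free_product J A G inj)
    (Hnt : forall j, nontrivial (A j))
    (n : nat) (Hn : 0 < n)
    (j1 j2 : J) (Hj : j1 <> j2)
    (a : A j1) (t : A j2) (Ha : a <> gone) (Ht : t <> gone)
    (oa ot : option nat) (Hoa : has_order a oa) (Hot : has_order t ot)
    (Hle : ord_le oa ot) :
  comm_length (gpow (comm (inj j1 a) (inj j2 t)) n)
              (n / 2 - div_ord n oa + 1).
Proof.
have order_a := has_order_is_order Hoa; move/ltP: Hn => n0.
rewrite Nat.add_1_r div_ordE Nat_divE divn2 gpowE; apply: comm_prod_comm_length => [|k klen].
- apply: comm_prod_commX_order n0; first by rewrite (is_order_eq1 order_a); apply/eqP.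
  by rewrite -(gmulfXn (inj j1)) (eqP (etrans (order_a _) (dvdnn _))) gmulf1.
- exact: (comm_prod_free_product_commX_gt HG Hj Ha Ht Hoa Hot Hle n0 klen).
Qed.
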